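(* Let $\Omega\subset\mathbb R^n$ be a bounded open domain of diameter $d$. Let $f\in C(\Omega)$ be bounded in $\Omega$. If $u\in C(\overline\Omega)$ is a viscosity solution of the equation $\mathcal M_{\mathbf a}(D^2u)=f$ in $\Omega$, with $\mathcal M_{\mathbf a}\in\mathcal A$, then $$\sup_{\Omega}|u|\le \sup_{\partial\Omega}|u|+\frac{C_n}{a^*}\,d\,\|f\|_{L^n(\Omega)},$$ where $C_n>0$ is a constant depending only on $n$.
   Context: For a real symmetric $n\times n$ matrix $X\in\mathcal S^n$, let $\lambda_1(X)\le\dots\le\lambda_n(X)$ be its eigenvalues. For $\mathbf a=(a_1,\dots,a_n)$ with $a_i\ge0$ for all $i$ and at least one $a_j>0$, set $\mathcal M_{\mathbf a}(X)=\sum_{i=1}^n a_i\lambda_i(X)$. $\mathcal A$ is the class of such operators with $a_1>0$ and $a_n>0$, and $a^*=\min(a_1,a_n)$. Viscosity notions: for an open set $\Omega$, an upper semicontinuous $u$ is a viscosity subsolution of $\mathcal M_{\mathbf a}(D^2u)=f$ (also written $\mathcal M_{\mathbf a}(D^2u)\ge f$) in $\Omega$ if $\mathcal M_{\mathbf a}(X)\ge f(x)$ for all $x\in\Omega$ and all $(\xi,X)\in\mathbb R^n\times\mathcal S^n$ such that $u(y)\le u(x)+\langle\xi,y-x\rangle+\frac12\langle X(y-x),y-x\rangle+o(|y-x|^2)$ as $y\to x$. A lower semicontinuous $u$ is a viscosity supersolution (written $\mathcal M_{\mathbf a}(D^2u)\le f$) if $\mathcal M_{\mathbf a}(X)\le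 f(x)$ for all $x\in\Omega$ and all $(\xi,X)$ such that $u(y)\ge u(x)+\langle\xi,y-x\rangle+\frac12\langle X(y-x),y-x\rangle+o(|y-x|^2)$ as $y\to x$. A viscosity solution is a continuous function that is both a sub- and a supersolution. *)

(* Defs.v *)
From HB Require Import structures.
From mathcomp Require Import all_boot all_order all_algebra.
From mathcomp Require Import all_classical all_reals all_analysis.
From mathcomp Require Import -(notations) complex.

Set Implicit Arguments.
Unset Strict Implicit.
Unset Printing Implicit Defensive.

Import Order.TTheory GRing.Theory Num.Theory.
Import numFieldNormedType.Exports.

Local Open Scope classical_set_scope.
Local Open Scope ring_scope.

Section Eigenvalues.
Context {R : realType}.

(* Roots of the characteristic polynomial in nondecreasing order, repeated
   according to multiplicity; [::] when it does not split over R, which does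
   not happen for symmetric X (eigenvaluesP). *)
Definition eigenvalues n (X : 'M[R]_n) : seq R :=
  xget [::] [set s | sorted <=%R s /\
                     char_poly X = \prod_(z <- s) ('X - z%:P)].

Lemma char_poly_conj (F : fieldType) n (P A : 'M[F]_n) : P \in unitmx ->
  char_poly (invmx P *m A *m P) = char_poly A.
Proof.
move=> uP; rewrite /char_poly.
have uP' : map_mx (@polyC F) P \in unitmx by rewrite map_unitmx.
rewrite (_ : char_poly_mx _ = invmx (map_mx polyC P) *m char_poly_mx A *m map_mx polyC P).
  by rewrite !det_mulmx det_inv mulrAC mulVr ?mul1r// -unitmxE.
rewrite /char_poly_mx !map_mxM map_invmx mulmxBr mulmxBl; congr (_ - _).
by rewrite scalar_mxC -mulmxA mulVmx// mulmx1.
Qed.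

Lemma eigenvaluesP n (X : 'M[R]_n) : X^T = X ->
  [/\ sorted <=%R (eigenvalues X), size (eigenvalues X) = n &
      char_poly X = \prod_(z <- eigenvalues X) ('X - z%:P)].
Proof.
move=> Xs; suff [s Es] : exists s : seq R, char_poly X = \prod_(z <- s) ('X - z%:P).
  have /(xgetPex [::])[/= so E] : exists s, [set s | sorted <=%R s /\
      char_poly X = \prod_(z <- s) ('X - z%:P)] s.
    exists (sort <=%R s); split; first exact: (sort_sorted le_total).
    by rewrite Es; apply: perm_big; rewrite perm_sym perm_sort.
  split=> //; have := size_char_poly X; rewrite E size_prod_XsubC => -[->] //.
pose C : numClosedFieldType := complex R.
pose g : {rmorphism R -> C} := real_complex_def (Phant R).
have greal z : g z \is Num.real by apply/complex_realP; exists z.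
have Yreal : map_mx g X \is a realmx by apply/mxOverP => i j; rewrite mxE.
have Ysym : map_mx g X \is symmetricmx.
  by apply/is_hermitianmxP; rewrite expr0 scale1r map_mx_id // map_trmx Xs.
have Yherm := realsym_hermsym Ysym Yreal.
have dreal := hermitian_spectral_diag_real Yherm.
have /orthomx_spectralP YE := symmetric_normalmx Ysym Yreal.
have /= gx i : exists x, spectral_diag (map_mx g X) 0 i == g x.
  have /complex_realP[x ->] : spectral_diag (map_mx g X) 0 i \is Num.real.
    by move/mxOverP: dreal; exact.
  by exists x.
exists [seq xchoose (gx i) | i <- index_enum 'I_n].
apply: (@map_poly_inj _ _ g); rewrite map_char_poly [in LHS]YE char_poly_conj; last first.
  exact: spectral_unit. 
rewrite char_poly_trig ?diag_mx_is_trig// big_map rmorph_prod.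
apply: eq_bigr => i _; rewrite mxE eqxx mulr1n [RHS](map_polyXsubC g).
by have /eqP E := xchooseP (gx i); congr ('X - _%:P).
Qed.
End Eigenvalues.

Section LebesgueRn.
Context {R : realType}.
Let T := measurableTypeR R.

Definition tuple_cons n (p : T * n.-tuple T) : n.+1.-tuple T :=
  [tuple of p.1 :: p.2].

Lemma measurable_tuple_cons n : measurable_fun setT (@tuple_cons n).
Proof. exact: (measurable_cons measurable_fst measurable_snd). Qed.

Section step.
Variables (n : nat) (m : {sigma_finite_measure set (n.-tuple T) -> \bar R}).

Definition lebesgue_cons : set (n.+1.-tuple T) -> \bar R :=
  pushforward (@lebesgue_measure R \x m)%E (@tuple_cons n).

Let lc0 : lebesgue_cons set0 = 0%E.
Proof. by rewrite /lebesgue_cons /pushforward preimage_set0 measure0. Qed.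

Let lc_ge0 A : (0 <= lebesgue_cons A)%E.
Proof. by rewrite /lebesgue_cons /pushforward measure_ge0. Qed.

Let lc_sigma_additive : semi_sigma_additive lebesgue_cons.
Proof.
have mcons A : measurable A -> measurable (@tuple_cons n @^-1` A).
  by move=> mA; rewrite -[X in measurable X]setTI; exact: measurable_tuple_cons.
move=> F mF tF mUF; rewrite /lebesgue_cons /pushforward preimage_bigcup.
apply: measure_semi_sigma_additive.
- by move=> k; exact: mcons.
- apply/trivIsetP => /= i j _ _ ij; rewrite -preimage_setI.
  by move/trivIsetP : tF => /(_ _ _ _ _ ij) ->//; rewrite preimage_set0.
- by rewrite -preimage_bigcup; exact: mcons.
Qed.

HB.instance Definition _ := isMeasure.Build _ _ _ lebesgue_cons
  lc0 lc_ge0 lc_sigma_additive.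

Let lc_sigma_finite : sigma_finite setT lebesgue_cons.
Proof.
have /sigma_finiteP[F [FT ndF Foo]] := sigma_finiteT (@lebesgue_measure R).
have /sigma_finiteP[G [GT ndG Goo]] := sigma_finiteT m.
pose head_set (A : set T) := (fun t : n.+1.-tuple T => tnth t ord0) @^-1` A.
pose tail_set (B : set (n.-tuple T)) :=
  (fun t : n.+1.-tuple T => [tuple of behead t]) @^-1` B.
exists (fun k => head_set (F k) `&` tail_set (G k)).
  apply/seteqP; split=> // t _.
  have [i _ Fi] : (\bigcup_i F i) (tnth t ord0) by rewrite -FT.
  have [j _ Gj] : (\bigcup_i G i) [tuple of behead t] by rewrite -GT.
  exists (maxn i j) => //; split.
    by have /subsetPset := ndF _ _ (leq_maxl i j); exact.
  by have /subsetPset := ndG _ _ (leq_maxr i j); exact.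
move=> k; have [mF Fk] := Foo k; have [mG Gk] := Goo k; split.
  apply: measurableI; rewrite -[X in measurable X]setTI.
    exact: measurable_tnth.
  exact: measurable_behead.
rewrite /lebesgue_cons /pushforward
  (_ : _ @^-1` _ = F k `*` G k) ?product_measure1E//.
  by rewrite lte_mul_pinfty// ge0_fin_numE.
apply/seteqP; split=> -[x t]; rewrite /head_set /tail_set /= (_ : [tuple of _] = t)//;
  exact/val_inj.
Qed.

HB.instance Definition _ := Measure_isSigmaFinite.Build _ _ _ lebesgue_cons
  lc_sigma_finite.
End step.

Definition lebesgue_nil : set (0.-tuple T) -> \bar R := dirac [tuple].
HB.instance Definition _ := Measure.on lebesgue_nil.
Let ln_sigma_finite : sigma_finite setT lebesgue_nil.
Proof.
exists (fun=> setT); first by rewrite bigcup_const//; exists 0%N.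
by move=> k; split=> //; rewrite /lebesgue_nil diracT ltry.
Qed.
HB.instance Definition _ := Measure_isSigmaFinite.Build _ _ _ lebesgue_nil
  ln_sigma_finite.

(* Lebesgue measure on R^n, carried by the product sigma-algebra on n-tuples of
   Borel reals: the n-fold product of the one-dimensional Lebesgue measure. *)
Fixpoint lebesgue_Rn n : {sigma_finite_measure set (n.-tuple T) -> \bar R} :=
  match n with
  | 0 => lebesgue_nil
  | n'.+1 => lebesgue_cons (lebesgue_Rn n')
  end.

Lemma lebesgue_Rn_box n (A : 'I_n -> set T) : (forall i, measurable (A i)) ->
  lebesgue_Rn n [set t | forall i, A i (tnth t i)] =
  (\prod_(i < n) lebesgue_measure (A i))%E.
Proof.
elim: n A => [|n IH] A mA.
  rewrite big_ord0 [LHS](_ : _ = lebesgue_nil setT).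
    by rewrite /lebesgue_nil diracT.
  by congr lebesgue_nil; apply/seteqP; split=> // t _ [].
have mbox (k : nat) (B : 'I_k -> set T) : (forall i, measurable (B i)) ->
    measurable [set t : k.-tuple T | forall i, B i (tnth t i)].
  move=> mB; rewrite (_ : mkset _ = \big[setI/setT]_(i < k) ((@tnth _ T ^~ i) @^-1` B i)).
    apply: bigsetI_measurable => i _; rewrite -[X in measurable X]setTI.
    exact: measurable_tnth.
  apply/seteqP; split=> t; rewrite -bigcap_seq /=.
    by move=> h i _; exact: h.
  by move=> h i; exact: (h i (mem_index_enum i)).
rewrite big_ord_recl -IH// -product_measure1E//; last first.
  by apply: (mbox n (fun i => A (lift ord0 i))).
rewrite /= /lebesgue_cons /pushforward; congr (product_measure1 _ _ _).
apply/seteqP; split=> -[x t] /=.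
  move=> h; split; first by have := h ord0.
  by move=> i; have := h (lift ord0 i); rewrite tnthS.
move=> [h0 h] i; have [j ->|->//] := unliftP ord0 i.
by rewrite tnthS; exact: h.
Qed.
End LebesgueRn.

Section EuclideanSpace.
Context {R : realType}.

Definition dotp n (x y : 'rV[R]_n) : R := (x *m y^T) 0 0.

(* The library norm on 'rV[R]_n is the sup norm; it only serves for the
   topology and for boundedness of sets. *)
Definition enorm n (x : 'rV[R]_n) : R := Num.sqrt (dotp x x).

Definition diameter n (A : set 'rV[R]_n) : R :=
  sup [set enorm (p.1 - p.2) | p in A `*` A].

Definition boundary n (A : set 'rV[R]_n.+1) : set 'rV[R]_n.+1 :=
  closure A `\` interior A.

Definition Lp_norm n (p : R) (A : set 'rV[R]_n) (f : 'rV[R]_n -> R) : \bar R :=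
  'N[lebesgue_Rn n]_(p%:E)[(fun t => ((f \_ A) (\row_i tnth t i))%:E)].

End EuclideanSpace.

Section Operators.
Context {R : realType} (n : nat).
Implicit Types (a : 'I_n.+1 -> R) (X : 'M[R]_n.+1).

(* Indices are shifted: a ord0 and a ord_max are a_1 and a_n of the usual
   1-based numbering, in dimension n.+1. *)
Definition weightedM a X : R := \sum_(i < n.+1) a i * (eigenvalues X)`_i.

Definition weights a : Prop := (forall i, 0 <= a i) /\ (exists j, 0 < a j).

Definition classA a : Prop := [/\ weights a, 0 < a ord0 & 0 < a ord_max].

Definition astar a : R := Num.min (a ord0) (a ord_max).

End Operators.

Section Viscosity.
Context {R : realType} (n : nat).
Implicit Types (Omega : set 'rV[R]_n.+1) (u f : 'rV[R]_n.+1 -> R).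
Implicit Types (x xi : 'rV[R]_n.+1) (X : 'M[R]_n.+1).

Definition usc_on Omega u : Prop :=
  forall x, Omega x -> forall c, u x < c ->
  \forall y \near within Omega (nbhs x), u y < c.

Definition lsc_on Omega u : Prop :=
  forall x, Omega x -> forall c, c < u x ->
  \forall y \near within Omega (nbhs x), c < u y.

Definition quadratic u x xi X (y : 'rV[R]_n.+1) : R :=
  u x + dotp xi (y - x) + 2^-1 * dotp ((y - x) *m X) (y - x).

Definition superjet u x xi X : Prop :=
  exists r : 'rV[R]_n.+1 -> R,
    (r =o_ (nbhs x) (fun y => enorm (y - x) ^+ 2)) /\
    (\forall y \near x, u y <= quadratic u x xi X y + r y).

Definition subjet u x xi X : Prop :=
  exists r : 'rV[R]_n.+1 -> R,
    (r =o_ (nbhs x) (fun y => enorm (y - x) ^+ 2)) /\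
    (\forall y \near x, u y >= quadratic u x xi X y + r y).

Definition visc_subsolution (F : 'M[R]_n.+1 -> R) f Omega u : Prop :=
  usc_on Omega u /\
  forall x xi X, Omega x -> X^T = X -> superjet u x xi X -> F X >= f x.

Definition visc_supersolution (F : 'M[R]_n.+1 -> R) f Omega u : Prop :=
  lsc_on Omega u /\
  forall x xi X, Omega x -> X^T = X -> subjet u x xi X -> F X <= f x.

Definition visc_solution (F : 'M[R]_n.+1 -> R) f Omega u : Prop :=
  [/\ {within Omega, continuous u}, visc_subsolution F f Omega u
    & visc_supersolution F f Omega u].

End Viscosity.

(* Main.v *)
Require Import Defs.
From mathcomp Require Import all_boot all_order all_algebra.
From mathcomp Require Import all_classical all_reals all_analysis.
From mathcomp Require Import measurable_realfun.
From mathcomp Require Import ring lra.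

(** Let N be the dimension, u a subsolution, and let a plane of slope p touch
    the graph of u from above over Omega at x; call p a contact slope at x.

    Fix z in Omega.  Sliding planes down shows that every slope whose sup norm
    is at most some h < (u z - sup of u over the boundary) / (N d) is a contact
    slope, at a point of a compact subset K of Omega that depends on h only
    (contact_exists, superlevel_compact).  So it suffices to bound the volume of the set of
    contact slopes by a multiple of the integral of (|f| / a^* )^N.

    The key is a quantitative form of the fact that at a contact point the
    Hessian is nonpositive, so that the equation bounds its lowest eigenvalue,
    a_1 lambda_1 >= f, hence all of them: if x0 and x1 are contact points at
    distance at most r, with slopes p0 and p1, then
        a_1 |p0 - p1| <= 6 N r |f y|
    for some y near x0 (contact_slope_gap).  Indeed u lies below the minimum of
    two planes with a wedge in the direction w = p0 - p1.  A paraboloid that is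
    concave along w and very slightly convex across w therefore touches
    u from above near x0, and its Hessian is a rank-one perturbation of a
    multiple of the identity, with explicit spectrum (weightedM_rank1_le).  The
    convexity needed is of order (r / rho)^2, where rho is the size of the
    neighbourhood, so its contribution, which carries the sum of all the
    weights, disappears as r -> 0 with rho fixed.

    Cut a box containing Omega into a grid of cubes of side r.  The contact
    slopes of the contact points lying in one cube fill at most a cube of side
    12 N r (|f x| + e) / a_1, x being any contact point of the cell, because f
    is uniformly continuous near K.  Summing volumes bounds the volume of the
    slope set by a lower Riemann sum of |f|^N plus an error of size e^N
    (slope_volume_le), and e -> 0 gives one_sided_estimate.

    A supersolution u is treated through - u: the same paraboloids, reflected,
    touch u from below, and the relevant eigenvalue is the largest one, with
    weight a_n (visc_supersolution_rank1).  Both weights are at least a^*. *)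

Set Implicit Arguments.
Unset Strict Implicit.
Unset Printing Implicit Defensive.

Import Order.TTheory GRing.Theory Num.Theory.
Import numFieldNormedType.Exports.

Local Open Scope classical_set_scope.
Local Open Scope ring_scope.

(** * The dot product and the sup norm *)

Section DotProduct.
Context {R : realType} {n : nat}.
Implicit Types (x y z : 'rV[R]_n) (k : R).

Lemma dotpE x y : dotp x y = \sum_i x 0 i * y 0 i.
Proof. by rewrite /dotp mxE; apply: eq_bigr => i _; rewrite mxE. Qed.

Lemma dotpC x y : dotp x y = dotp y x.
Proof. by rewrite !dotpE; apply: eq_bigr => i _; rewrite mulrC. Qed.

Lemma dotpDl x y z : dotp (x + y) z = dotp x z + dotp y z.
Proof. by rewrite /dotp mulmxDl mxE. Qed.

Lemma dotpZl k x z : dotp (k *: x) z = k * dotp x z.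
Proof. by rewrite /dotp -scalemxAl mxE. Qed.

Lemma dotpNl x z : dotp (- x) z = - dotp x z.
Proof. by rewrite -scaleN1r dotpZl mulN1r. Qed.

Lemma dotpBl x y z : dotp (x - y) z = dotp x z - dotp y z.
Proof. by rewrite dotpDl dotpNl. Qed.

Lemma dotpDr x y z : dotp z (x + y) = dotp z x + dotp z y.
Proof. by rewrite !(dotpC z) dotpDl. Qed.

Lemma dotpBr x y z : dotp z (x - y) = dotp z x - dotp z y.
Proof. by rewrite !(dotpC z) dotpBl. Qed.

Lemma dotp0l x : dotp 0 x = 0.
Proof. by rewrite dotpE big1// => i _; rewrite mxE mul0r. Qed.

Lemma dotp0r x : dotp x 0 = 0.
Proof. by rewrite dotpC dotp0l. Qed.

Lemma dotp_ge0 x : 0 <= dotp x x.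
Proof. by rewrite dotpE; apply: sumr_ge0 => i _; rewrite -expr2 sqr_ge0. Qed.

Lemma coord_le_norm x i : `|x 0 i| <= `|x|.
Proof.
rewrite [leRHS]mx_normrE; apply/bigmax_geP; right => /=.
by exists (ord0, i).
Qed.

Lemma norm_le_coord x k : 0 <= k -> (forall i, `|x 0 i| <= k) -> `|x| <= k.
Proof.
move=> k0 xk; rewrite [leLHS]mx_normrE; apply/bigmax_leP; split => //=.
by move=> [i j] _ /=; rewrite ord1.
Qed.

Lemma norm_coord_ex x : `|x| != 0 -> exists i, `|x| = `|x 0 i|.
Proof. by move=> /mx_norm_neq0[[i j] E]; exists j; rewrite [LHS]E/= ord1. Qed.

Lemma dotp_le_norm x y : `|dotp x y| <= n%:R * `|x| * `|y|.
Proof.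
rewrite dotpE (le_trans (ler_norm_sum _ _ _))//.
rewrite (@le_trans _ _ (\sum_(i < n) `|x| * `|y|))//.
  by apply: ler_sum => i _; rewrite normrM ler_pM// coord_le_norm.
by rewrite sumr_const card_ord -[leLHS]mulr_natl mulrA.
Qed.

Lemma sqr_norm_le_dotp x : `|x| ^+ 2 <= dotp x x.
Proof.
have [->|/norm_coord_ex[i ->]] := eqVneq `|x| 0.
  by rewrite expr0n/= dotp_ge0.
rewrite dotpE (bigD1 i)//= -normrX expr2 ger0_norm -?expr2 ?sqr_ge0//.
by rewrite lerDl sumr_ge0// => j _; rewrite -expr2 sqr_ge0.
Qed.

Lemma norm_le_enorm x : `|x| <= enorm x.
Proof.
by rewrite -[leLHS](ger0_norm (normr_ge0 x)) -sqrtr_sqr ler_wsqrtr// sqr_norm_le_dotp.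
Qed.

Lemma enorm_le_norm x (k : R) : `|x| <= k -> enorm x <= n%:R * k + 1.
Proof.
move=> xk; have k0 : 0 <= k by rewrite (le_trans _ xk).
rewrite -[leRHS]ger0_norm; last by rewrite addr_ge0// mulr_ge0.
rewrite -sqrtr_sqr ler_wsqrtr//; apply: (le_trans (ler_norm _)).
rewrite (le_trans (dotp_le_norm _ _))// -mulrA.
rewrite (@le_trans _ _ (n%:R * (k * k)))//.
  by rewrite ler_wpM2l// ler_pM.
have [->|n0] := eqVneq n 0%N; first by rewrite mul0r sqr_ge0.
have n1 : (1 : R) <= n%:R by rewrite ler1n lt0n.
have : n%:R * k * (n%:R - 1) * k >= 0 by rewrite !mulr_ge0// subr_ge0.
nra.
Qed.

End DotProduct.

(** * Spectrum of the barrier Hessians *)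

Section RankOne.
Context {R : realType} {n : nat}.
Implicit Types (w x : 'rV[R]_n.+1) (a : 'I_n.+1 -> R) (d k : R).

(** Hessian of x |-> d/2 |x|^2 - k/2 (w.x)^2, the shape of every paraboloid used
    as a test function. *)
Definition rank1_hess d k w : 'M[R]_n.+1 := d%:M - k *: (w^T *m w).

Lemma rank1_hess_sym d k w : (rank1_hess d k w)^T = rank1_hess d k w.
Proof.
by rewrite /rank1_hess linearB/= tr_scalar_mx linearZ/= trmx_mul trmxK.
Qed.

Lemma mul_rank1_hess d k w x :
  x *m rank1_hess d k w = d *: x - (k * dotp x w) *: w.
Proof.
rewrite /rank1_hess mulmxBr mul_mx_scalar -scalemxAr mulmxA.
by rewrite [x *m _]mx11_scalar mul_scalar_mx scalerA.
Qed.

Lemma mem_eigenvalues (X : 'M[R]_n.+1) z : X^T = X ->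
  (z \in eigenvalues X) = eigenvalue X z.
Proof.
by move=> /eigenvaluesP[_ _ E]; rewrite eigenvalue_root_char E root_prod_XsubC.
Qed.

Lemma rank1_hess_eigenvalue d k w : w != 0 ->
  eigenvalue (rank1_hess d k w) (d - k * dotp w w).
Proof.
by move=> w0; apply/eigenvalueP; exists w => //; rewrite mul_rank1_hess scalerBl.
Qed.

Lemma rank1_hess_eigenvalueP d k w z : eigenvalue (rank1_hess d k w) z ->
  z = d \/ z = d - k * dotp w w.
Proof.
move=> /eigenvalueP[v]; rewrite mul_rank1_hess => E v0.
have [->|zd] := eqVneq z d; [by left|right].
have {}E : (d - z) *: v = (k * dotp v w) *: w.
  by rewrite scalerBl -E opprB addrC subrK.
have vw : dotp v w != 0.
  apply: contra v0 => /eqP vw; move: E; rewrite vw mulr0 scale0r => /eqP.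
  by rewrite scaler_eq0 subr_eq0 eq_sym (negPf zd).
have := congr1 (fun y => dotp y w) E; rewrite !dotpZl => E'.
apply: (mulIf vw); rewrite mulrBl.
by move: E'; rewrite mulrBl => E'; lra.
Qed.

(** The lowest eigenvalue is the one with eigenvector [w]; [d] bounds all the
    others. *)
Lemma weightedM_rank1_le a d k w : (forall i, 0 <= a i) -> 0 <= k ->
  weightedM a (rank1_hess d k w) <= d * (\sum_i a i) - a ord0 * (k * dotp w w).
Proof.
move=> a0 k0; have Xs := rank1_hess_sym d k w.
have [es esz _] := eigenvaluesP Xs.
set X := rank1_hess d k w in Xs es esz *.
have e_le (i : 'I_n.+1) : (eigenvalues X)`_i <= d.
  have : (eigenvalues X)`_i \in eigenvalues X by rewrite mem_nth// esz.
  rewrite (mem_eigenvalues _ Xs) => /rank1_hess_eigenvalueP[->//|->].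
  by rewrite gerBl mulr_ge0// dotp_ge0.
have e0_le : (eigenvalues X)`_0 <= d - k * dotp w w.
  have [->|w0] := eqVneq w 0; first by rewrite /dotp mul0mx mxE mulr0 subr0 (e_le ord0).
  have /(nthP 0)[i] : d - k * dotp w w \in eigenvalues X.
    by rewrite (mem_eigenvalues _ Xs) rank1_hess_eigenvalue.
  move=> ilt <-; apply: (sorted_leq_nth le_trans le_refl) => //.
  by rewrite inE esz.
rewrite /weightedM big_ord_recl/= big_ord_recl/= mulrDr.
have : \sum_(i < n) a (lift ord0 i) * (eigenvalues X)`_(bump 0 i)
    <= d * \sum_(i < n) a (lift ord0 i).
  by rewrite mulr_sumr; apply: ler_sum => i _; rewrite mulrC ler_wpM2r// (e_le (lift ord0 i)).
have := ler_wpM2l (a0 ord0) e0_le.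
nra.
Qed.

(** The reflected barrier: negation reverses the order of the eigenvalues, so
    the last weight replaces the first. *)
Lemma weightedM_rank1_ge a d k w : (forall i, 0 <= a i) -> 0 <= k ->
  a ord_max * (k * dotp w w) - d * (\sum_i a i) <= weightedM a (- rank1_hess d k w).
Proof.
move=> a0 k0; set X := rank1_hess d k w.
have Xs : (- X)^T = - X by rewrite linearN/= rank1_hess_sym.
have [es esz _] := eigenvaluesP Xs.
have eN z : eigenvalue (- X) z -> eigenvalue X (- z).
  move=> /eigenvalueP[v vE v0]; apply/eigenvalueP; exists v => //.
  by rewrite scaleNr -vE mulmxN opprK.
have e_ge (i : 'I_n.+1) : - d <= (eigenvalues (- X))`_i.
  have : (eigenvalues (- X))`_i \in eigenvalues (- X) by rewrite mem_nth// esz.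
  rewrite (mem_eigenvalues _ Xs) => /eN/rank1_hess_eigenvalueP[<-|E]; first by rewrite opprK.
  by rewrite lerNl E gerBl mulr_ge0// dotp_ge0.
have en_ge : k * dotp w w - d <= (eigenvalues (- X))`_n.
  have [->|w0] := eqVneq w 0.
    by rewrite /dotp mul0mx mxE mulr0 sub0r (e_ge ord_max).
  have /(nthP 0)[i] : k * dotp w w - d \in eigenvalues (- X).
    rewrite (mem_eigenvalues _ Xs); apply/eigenvalueP; exists w => //.
    by rewrite mulmxN mul_rank1_hess -scalerBl -scaleNr opprB.
  move=> ilt <-; apply: (sorted_leq_nth le_trans le_refl) => //.
    by rewrite inE esz.
  by move: ilt; rewrite esz ltnS.
rewrite /weightedM big_ord_recr/= big_ord_recr/= mulrDr.
have : - d * \sum_(i < n) a (widen_ord (leqnSn n) i) <=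
    \sum_(i < n) a (widen_ord (leqnSn n) i) * (eigenvalues (- X))`_i.
  rewrite mulr_sumr; apply: ler_sum => i _; rewrite mulrC ler_wpM2l//.
  exact: (e_ge (widen_ord (leqnSn n) i)).
have := ler_wpM2l (a0 ord_max) en_ge.
nra.
Qed.
End RankOne.

(** * Contact slopes at nearby points *)

Section Barrier.
Context {R : realType} {n : nat}.
Implicit Types (w x y p : 'rV[R]_n.+1) (v g : 'rV[R]_n.+1 -> R).
Implicit Types (Omega : set 'rV[R]_n.+1).

Lemma dotp_continuous p : continuous (dotp p).
Proof.
rewrite (_ : dotp p = fun y => \sum_i p 0 i * y 0 i); last exact/funext/dotpE.
have cM i : continuous (fun y : 'rV[R]_n.+1 => p 0 i * y 0 i).
  by move=> y; apply: continuousM; [exact: cst_continuous|exact: coord_continuous].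
exact: (continuous_big (@add_continuous R^o)).
Qed.

Lemma dotp_self_continuous : continuous (fun y : 'rV[R]_n.+1 => dotp y y).
Proof.
rewrite (_ : (fun y => _) = fun y => \sum_i y 0 i * y 0 i); last first.
  by apply/funext => y; rewrite dotpE.
have cM i : continuous (fun y : 'rV[R]_n.+1 => y 0 i * y 0 i).
  by move=> y; apply: continuousM; exact: coord_continuous.
exact: (continuous_big (@add_continuous R^o)).
Qed.

Lemma sub_continuous x : continuous (fun z : 'rV[R]_n.+1 => z - x).
Proof.
by move=> z; apply: (@continuousB _ 'rV[R]_n.+1);
  [exact: cvg_id | exact: cst_continuous].
Qed.

Lemma dotp_sub_continuous p x : continuous (fun z : 'rV[R]_n.+1 => dotp p (z - x)).
Proof.
move=> z; apply: (@continuous_comp _ _ _ (fun z : 'rV[R]_n.+1 => z - x)).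
  exact: sub_continuous.
exact: dotp_continuous.
Qed.

(** A paraboloid with vertex data at [x] that touches [v] from above at [y] is
    re-expanded around [y]. *)
Lemma superjet_quadratic v x y p (X : 'M[R]_n.+1) : X^T = X ->
  let Q (z : 'rV[R]_n.+1) := dotp p (z - x) + 2^-1 * dotp ((z - x) *m X) (z - x) in
  (\forall z \near y, v z - Q z <= v y - Q y) ->
  superjet v y (p + (y - x) *m X) X.
Proof.
move=> Xs Q vQ; exists (fun=> 0); split.
  apply/eqoP => e e0; by near=> z; rewrite normr0 mulr_ge0 ?(ltW e0).
apply: filterS vQ => z; rewrite addr0.
rewrite /quadratic /Q.
rewrite (_ : z - x = (z - y) + (y - x)); last by rewrite addrA subrK.
have sX (a b : 'rV[R]_n.+1) : dotp (a *m X) b = dotp (b *m X) a.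
  by rewrite [RHS]dotpC /dotp trmx_mul Xs mulmxA.
move: (z - y) (y - x) => a b.
rewrite !mulmxDl !dotpDl !dotpDr (sX a b).
lra.
Unshelve. all: by end_near. Qed.

(** What is kept of the equation: it is tested against the barriers only, with
    [alpha] the extreme weight and [S] the sum of the weights.  In this form it
    holds both for a subsolution and for the opposite of a supersolution. *)
Definition rank1_subsolution (alpha S : R) g Omega v :=
  forall x xi (d k : R) w, Omega x -> 0 <= k ->
    superjet v x xi (rank1_hess d k w) ->
    alpha * (k * dotp w w) <= g x + d * S.

Definition contact Omega v p x :=
  forall y, Omega y -> v y <= v x + dotp p (y - x).

(** Put t = w.(y - x0), w = p0 - p1, m = N |w| r.  After subtracting the plane at
    [x0], [v] is at most min(0, m - t).  The barrier is
    - (t^2 + m t) / (6 m) + (m / rho^2) |y - x0|^2 on the slab -m <= t <= 2 m inside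
    the ball of radius [rho].  It vanishes with [v] at [x0] and dominates [v] on
    the boundary of the slab and of the ball, so [v] minus the barrier has an
    interior maximum.  There the equation reads
    alpha |w|^2 / (3 m) <= g + 2 m S / rho^2, and the smallness of r / rho lets
    half of the left side absorb the last term. *)
Lemma contact_slope_gap (alpha S r rho : R) g Omega v x0 x1 p0 p1 :
  rank1_subsolution alpha S g Omega v ->
  (forall y, Omega y -> {for y, continuous v}) ->
  (forall y, 0 <= g y) -> 0 < alpha -> 0 < r -> 0 < rho ->
  12 * n.+1%:R ^+ 2 * S * r ^+ 2 <= alpha * rho ^+ 2 ->
  (forall y, `|y - x0| <= rho -> Omega y) -> Omega x1 -> `|x1 - x0| <= r ->
  contact Omega v p0 x0 -> contact Omega v p1 x1 ->
  exists2 y, `|y - x0| <= rho & alpha * `|p0 - p1| <= 6 * n.+1%:R * r * g y.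
Proof.
move=> vsub vcont g0 alpha0 r0 rho0 Sr ballO Ox1 x10 c0 c1.
have [w wE] : exists w, w = p0 - p1 by exists (p0 - p1).
rewrite -wE.
have [w0|w_neq0] := eqVneq `|w| 0.
  exists x0; first by rewrite subrr normr0 ltW.
  by rewrite w0 mulr0 !mulr_ge0// ltW.
have w_gt0 : 0 < `|w| by rewrite lt_def w_neq0 normr_ge0.
have N0 : 0 < n.+1%:R :> R by rewrite ltr0n.
set N : R := n.+1%:R in N0 Sr *.
pose m := N * `|w| * r.
have m0 : 0 < m by rewrite !mulr_gt0.
pose k := (3 * m)^-1; pose d := 2 * m / rho ^+ 2.
have k0 : 0 <= k by rewrite invr_ge0 mulr_ge0// ltW.
pose p := p0 - 6^-1 *: w.
pose X := rank1_hess d k w.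
pose Q (z : 'rV[R]_n.+1) := dotp p (z - x0) + 2^-1 * dotp ((z - x0) *m X) (z - x0).
have QE (z : 'rV[R]_n.+1) : Q z =
    dotp p0 (z - x0) -
    (6 * m)^-1 * (dotp w (z - x0) ^+ 2 + m * dotp w (z - x0))
    + m / rho ^+ 2 * dotp (z - x0) (z - x0).
  rewrite /Q /p /X; move: (z - x0) => b.
  rewrite mul_rank1_hess !dotpBl !dotpZl (dotpC b w) /k /d.
  by field; rewrite !gt_eqF.
pose D := [set z : 'rV[R]_n.+1 | [/\ `|z - x0| <= rho, - m <= dotp w (z - x0)
  & dotp w (z - x0) <= 2 * m]].
have cw := @dotp_sub_continuous w x0.
have Dx0 : D x0.
  by rewrite /D/= subrr normr0 dotp0r ?(ltW rho0)//; split; lra.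
have cN : continuous (fun z : 'rV[R]_n.+1 => `|z - x0|).
  move=> z; apply: (@continuous_comp _ _ _ (fun z : 'rV[R]_n.+1 => z - x0)).
    exact: sub_continuous.
  exact: norm_continuous.
have cptD : compact D.
  apply: bounded_closed_compact.
    exists (rho + `|x0|); split; first exact: num_real.
    move=> M rM z [zr _ _]; apply: (le_trans _ (ltW rM)).
    by rewrite -[z](subrK x0); apply: (le_trans (ler_normD _ _)); rewrite lerD2r.
  rewrite (_ : D = (fun z => `|z - x0|) @^-1` [set t | t <= rho] `&`
     ((fun z => dotp w (z - x0)) @^-1` [set t | - m <= t] `&`
      (fun z => dotp w (z - x0)) @^-1` [set t | t <= 2 * m])).
    apply: closedI; first by apply: closed_comp => [z _|]; [exact: cN|exact: closed_le].
    by apply: closedI; apply: closed_comp => [z _|];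
      [exact: cw|exact: closed_ge|exact: cw|exact: closed_le].
  by apply/seteqP; split=> z /=; [move=> []|move=> [? []]].
have DO z : D z -> Omega z by move=> [? _ _]; exact: ballO.
have cQ : continuous Q.
  have cD (f h : 'rV[R]_n.+1 -> R) : continuous f -> continuous h ->
      continuous (fun z => f z + h z).
    by move=> cf ch z; apply: (@continuousD R R^o); [exact: cf|exact: ch].
  have cM (f h : 'rV[R]_n.+1 -> R) : continuous f -> continuous h ->
      continuous (fun z => f z * h z).
    by move=> cf ch z; apply: continuousM; [exact: cf|exact: ch].
  have cc (c : R) : continuous (fun _ : 'rV[R]_n.+1 => c) by exact: cst_continuous.
  rewrite (_ : Q = fun z => dotp p0 (z - x0) +
      - (6 * m)^-1 * (dotp w (z - x0) * dotp w (z - x0) + m * dotp w (z - x0)) +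
      m / rho ^+ 2 * dotp (z - x0) (z - x0)); last first.
    by apply/funext => z; rewrite QE mulNr expr2.
  apply: (cD).
    apply: (cD); first exact: dotp_sub_continuous.
    by apply: (cM); [exact: cc|apply: (cD); apply: (cM) => //; exact: cc].
  apply: (cM); first exact: cc.
  move=> z.
  apply: (@continuous_comp _ _ _ (fun z : 'rV[R]_n.+1 => z - x0)
    (fun y : 'rV[R]_n.+1 => dotp y y)); first exact: sub_continuous.
  exact: dotp_self_continuous.
have [y /set_mem Dy ymax] : exists2 y, y \in D & forall t, t \in D -> v t - Q t <= v y - Q y.
  apply: compact_EVT_max => //; first by exists x0.
  apply: continuous_in_subspaceT => z /set_mem Dz.
  by apply: (@continuousB R R^o); [exact/vcont/DO | exact: cQ].
have Qx0 : Q x0 = 0 by rewrite QE subrr !dotp0r; ring.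
(* On the boundary of the slab and of the ball the barrier dominates v, so a
   point where v exceeds it is interior. *)
have strict z : D z -> v x0 < v z - Q z ->
    [/\ `|z - x0| < rho, - m < dotp w (z - x0) & dotp w (z - x0) < 2 * m].
  move=> Dz; rewrite QE; have [z1 z2 z3] := Dz.
  have := c0 z (DO _ Dz); have := c1 z (DO _ Dz); have := c0 x1 Ox1.
  have : dotp w (x1 - x0) <= m.
    rewrite (le_trans (ler_norm _))// (le_trans (dotp_le_norm _ _))//.
    by rewrite /m ler_wpM2l// mulr_ge0// ltW.
  have -> : dotp p1 (z - x1) = dotp p0 (z - x0) - dotp w (z - x0) -
      dotp p0 (x1 - x0) + dotp w (x1 - x0).
    by rewrite wE !dotpBl !dotpBr; ring.
  move: z2 z3; set t := dotp w (z - x0); set A := dotp p0 (z - x0).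
  have zz0 : 0 <= m / rho ^+ 2 * dotp (z - x0) (z - x0).
    by rewrite mulr_ge0 ?dotp_ge0// divr_ge0// ltW// exprn_gt0.
  move=> z2 z3 h1 h2 h3 h4 h5; split.
  - rewrite lt_neqAle z1 andbT; apply/negP => /eqP zrho.
    have hz : m <= m / rho ^+ 2 * dotp (z - x0) (z - x0).
      rewrite mulrAC ler_pdivlMr ?exprn_gt0// ler_wpM2l ?(ltW m0)//.
      by rewrite -zrho sqr_norm_le_dotp.
    have : (6 * m)^-1 * (t ^+ 2 + m * t) <= m.
      rewrite mulrC ler_pdivrMr ?mulr_gt0//.
      have := mulr_ge0 (ltac:(lra) : 0 <= 2 * m - t) (ltac:(lra) : 0 <= t + m).
      have := mulr_ge0 (ltW m0) (ltac:(lra) : 0 <= 2 * m - t).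
      by move: (m) (t) => m' t'; lra.
    lra.
  - rewrite lt_neqAle z2 andbT; apply/negP => /eqP tm.
    move: h5; rewrite -tm (_ : (- m) ^+ 2 + m * - m = 0); last by ring.
    lra.
  - rewrite lt_neqAle z3 andbT; apply/negP => /eqP tm.
    move: h5; rewrite tm (_ : (6 * m)^-1 * _ = m); last by field; rewrite gt_eqF.
    lra.
(* If the maximum does not exceed the value at the interior point x0, then x0
   is itself a maximum point. *)
have {y Dy ymax}[y [y1 y2 y3] ymax] : exists2 y,
    [/\ `|y - x0| < rho, - m < dotp w (y - x0) & dotp w (y - x0) < 2 * m]
    & forall t, D t -> v t - Q t <= v y - Q y.
  have [lt|ge] := ltP (v x0) (v y - Q y).
    by exists y; [exact: strict | move=> t /mem_set; exact: ymax].
  exists x0; last first.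
    by move=> t /mem_set/ymax/le_trans -> //; rewrite Qx0 subr0.
  by rewrite subrr normr0 dotp0r; split; lra.
have ysup : \forall z \near y, v z - Q z <= v y - Q y.
  have /cvgr_lt/(_ _ y1) n1 : `|z - x0| @[z --> y] --> `|y - x0| by exact: cN.
  have /cvgr_gt/(_ _ y2) n2 : dotp w (z - x0) @[z --> y] --> dotp w (y - x0) by exact: cw.
  have /cvgr_lt/(_ _ y3) n3 : dotp w (z - x0) @[z --> y] --> dotp w (y - x0) by exact: cw.
  near=> z; apply: ymax; split; apply: ltW; near: z.
  - exact: n1.
  - exact: n2.
  - exact: n3.
exists y; first exact: ltW.
have Oy : Omega y by apply: ballO; exact: ltW.
have /(superjet_quadratic (rank1_hess_sym d k w)) jet := ysup.
have := vsub _ _ _ _ _ Oy k0 jet.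
have kw : `|w| / (3 * N * r) <= k * dotp w w.
  rewrite /k [leRHS]mulrC ler_pdivlMr ?mulr_gt0//.
  rewrite [leLHS](_ : _ = `|w| ^+ 2) ?sqr_norm_le_dotp// /m.
  by field; rewrite !gt_eqF.
have dS : d * S <= alpha * `|w| / (6 * N * r).
  rewrite ler_pdivlMr ?mulr_gt0//.
  have -> : d * S * (6 * N * r) = `|w| * (12 * N ^+ 2 * S * r ^+ 2 / rho ^+ 2).
    by rewrite /d /m; ring.
  by rewrite mulrC ler_pM2r// ler_pdivrMr ?exprn_gt0.
have E1 : `|w| / (3 * N * r) = 2 * (`|w| / (6 * N * r)).
  by field; rewrite !gt_eqF.
move=> h; move: kw dS; rewrite E1 -(ler_pM2l alpha0) mulrCA -[alpha * _ / _]mulrA => kw dS.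
have : alpha * (`|w| / (6 * N * r)) <= g y.
  by move: h kw dS; move: (alpha * _) (alpha * _) (d * S) => a1 a2 a3; lra.
by rewrite mulrA ler_pdivrMr ?mulr_gt0// [g y * _]mulrC.
Unshelve. all: by end_near.
Qed.
End Barrier.

(** * Existence and compactness of contact points *)

Section ContactSet.
Context {R : realType} {n : nat}.
Implicit Types (x y p : 'rV[R]_n.+1) (v f : 'rV[R]_n.+1 -> R).
Implicit Types (Omega K : set 'rV[R]_n.+1).


(** The contact point is a maximum point of v - p.(y - x) over the closure; it is
    not on the boundary because sliding costs at most N h delta.  The last
    conclusion confines all these points to one superlevel set. *)
Lemma contact_exists Omega v x (b h delta : R) p :
  open Omega -> compact (closure Omega) ->
  {within closure Omega, continuous v} ->
  (forall y, boundary Omega y -> v y <= b) -> Omega x ->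
  (forall y, closure Omega y -> `|y - x| <= delta) ->
  n.+1%:R * h * delta < v x - b -> `|p| <= h ->
  exists y, [/\ Omega y, contact Omega v p y & v x - n.+1%:R * h * delta <= v y].
Proof.
move=> oO cO vc vb Ox Od hb ph.
have [y /set_mem yO ymax] : exists2 y, y \in closure Omega &
    forall t, t \in closure Omega -> v t - dotp p (t - x) <= v y - dotp p (y - x).
  apply: compact_EVT_max => //; first by exists x; exact: subset_closure.
  move=> t; apply: (@continuousB R R^o (subspace (closure Omega)) v
    (fun t : 'rV[R]_n.+1 => dotp p (t - x))).
    exact: vc.
  by apply: continuous_subspaceT; exact: dotp_sub_continuous.
have h0 : 0 <= h by rewrite (le_trans _ ph).
have vy : v x - n.+1%:R * h * delta <= v y.
  have := ymax x; rewrite subrr dotp0r subr0 => /(_ (mem_set (subset_closure Ox))).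
  have : `|dotp p (y - x)| <= n.+1%:R * h * delta.
    rewrite (le_trans (dotp_le_norm _ _))// ler_pM ?mulr_ge0//.
      by rewrite ler_wpM2l.
    exact: Od.
  rewrite ler_norml => /andP[]; lra.
exists y; split => //.
  have [//|yNO] := pselect (Omega y).
  have : v y <= b by apply: vb; split=> // /interior_subset.
  lra.
move=> t Ot; have := ymax t (mem_set (subset_closure Ot)).
by rewrite (_ : t - y = (t - x) - (y - x)) ?dotpBr; [lra | rewrite opprB addrA subrK].
Qed.

(** When [c] exceeds the boundary values of [v], this compact set lies inside
    the open set, so [f] is uniformly continuous near it. *)
Lemma superlevel_compact Omega v (c : R) : compact (closure Omega) ->
  {within closure Omega, continuous v} ->
  compact (closure Omega `&` [set x | c <= v x]).
Proof.
move=> cO vc.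
have /closed_subspaceP[V cV VE] :
    closed (v @^-1` [set t | c <= t] : set (subspace (closure Omega))).
  by apply: preimage_closed => [t _|]; [exact: vc | exact: closed_ge].
rewrite setIC (_ : _ `&` _ = closure Omega `&` V); first exact: compact_closedI.
by rewrite [RHS]setIC VE.
Qed.

Lemma compact_uniform_near Omega K f (e : R) :
  open Omega -> compact K -> K `<=` Omega ->
  (forall x, Omega x -> {for x, continuous f}) -> 0 < e ->
  exists2 rho, 0 < rho & forall x y, K x -> `|y - x| <= rho ->
    Omega y /\ `|f y - f x| <= e.
Proof.
move=> oO cK KO fc e0.
have /compact_near_coveringP nK := cK.
have : \forall rho \near 0^'+, K `<=` (fun x => forall y, `|y - x| <= rho ->
    Omega y /\ `|f y - f x| <= e).
  apply: nK => x Kx.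
  have e20 : 0 < e / 2 by rewrite divr_gt0.
  have : \forall y \near x, Omega y /\ `|f x - f y| < e / 2.
    apply: filterI; first by apply: open_nbhs_nbhs; split => //; exact: KO.
    by have /cvgrPdist_lt/(_ _ e20) := fc x (KO _ Kx).
  move=> /nbhs_ballP[eta /= eta0 near_x].
  have eta20 : 0 < eta / 2 by rewrite divr_gt0.
  exists (ball x (eta / 2), [set rho | rho < eta / 2]).
    by split => /=; [exact: nbhsx_ballx | exact: nbhs_right_lt].
  move=> [x' rho] [/= xx' rho_lt] y yx'.
  have [|Oy fy] := near_x y.
    apply: (ball_split xx'); rewrite -ball_normE/= distrC.
    by rewrite (le_lt_trans yx').
  have [|_ fx'] := near_x x'; first by apply: le_ball xx'; lra.
  split=> //; move: fy fx'; rewrite !ltr_norml ler_norml => /andP[? ?] /andP[? ?].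
  by apply/andP; split; lra.
move=> near_rho; near (0 : R)^'+ => rho; exists rho.
  by near: rho; exact: nbhs_right_gt.
move=> x y Kx; have : K `<=` (fun x => forall y, `|y - x| <= rho ->
    Omega y /\ `|f y - f x| <= e) by near: rho.
by move=> /(_ _ Kx)/(_ y).
Unshelve. all: by end_near. Qed.

Lemma open_shift Omega y : open Omega -> Omega y ->
  exists2 e : R, 0 < e & Omega (y + const_mx e).
Proof.
move=> oO Oy; have : nbhs y Omega by exact: open_nbhs_nbhs.
move=> /nbhs_ballP[e /= e0 ball_sub]; exists (e / 2); first by rewrite divr_gt0.
apply: ball_sub; rewrite -ball_normE/= opprD addrA subrr add0r normrN.
apply: (@le_lt_trans _ _ (e / 2)); last by lra.
by apply: norm_le_coord => [|i]; rewrite ?mxE ?ger0_norm//; lra.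
Qed.

(** The supremum over the boundary is not over the empty set: the first
    coordinate attains its maximum over the closure, and not in [Omega]. *)
Lemma boundary_nonempty Omega : open Omega -> Omega !=set0 ->
  compact (closure Omega) -> boundary Omega !=set0.
Proof.
move=> oO [x0 Ox0] cO; apply: contrapT => /forallNP bO.
have cl_sub y : closure Omega y -> Omega y.
  by move=> cy; apply: contrapT => yO; apply: (bO y); split=> // /interior_subset.
have [y /set_mem yO ymax] : exists2 y, y \in closure Omega &
    forall t, t \in closure Omega -> t 0 ord0 <= y 0 ord0.
  apply: compact_EVT_max => //; first by exists x0; exact: subset_closure.
  by apply: continuous_subspaceT => t; exact: coord_continuous.
have [e e0 Oz] := open_shift oO (cl_sub _ yO).
by move: Oz => /subset_closure/mem_set/ymax; rewrite !mxE; lra.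
Qed.

End ContactSet.

(** * Finite covers and lower sums *)

Section FiniteCovers.
Import HBNNSimple.
Context {d : measure_display} {T : measurableType d} {R : realType}.
Variable mu : {measure set T -> \bar R}.

Lemma measure_le_sum_cover (I : Type) (s : seq I) (P : pred I) (A : I -> set T)
    (B : set T) : (forall i, measurable (A i)) -> measurable B ->
  B `<=` \big[setU/set0]_(i <- s | P i) A i ->
  (mu B <= \sum_(i <- s | P i) mu (A i))%E.
Proof.
move=> mA mB BA; apply: (@le_trans _ _ (mu (\big[setU/set0]_(i <- s | P i) A i))).
  by apply: le_measure => //; rewrite inE//; exact: bigsetU_measurable.
elim: s {BA} => [|i s IH]; first by rewrite !big_nil measure0.
rewrite !big_cons; case: ifP => // Pi.
apply: (le_trans (measureU2 _ _ _)) => //; first exact: bigsetU_measurable.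
exact: leeD2l.
Qed.

(** The integral of a nonnegative function is the supremum over the simple
    functions below it, and the step function with values [c] is one of them. *)
Lemma integral_ge_lower_sum (I : finType) (Q : I -> set T) (c : I -> R)
    (F : T -> \bar R) :
  (forall i, measurable (Q i)) -> trivIset setT Q -> (forall i, 0 <= c i) ->
  (forall t, (0 <= F t)%E) -> (forall i t, Q i t -> ((c i)%:E <= F t)%E) ->
  (\sum_i (c i)%:E * mu (Q i) <= \int[mu]_t F t)%E.
Proof.
move=> mQ tQ c0 F0 cF.
pose h : {nnsfun T >-> R} :=
  \big[add_nnsfun/nnsfun0]_i scale_nnsfun (indic_nnsfun R (mQ i)) (c0 i).
have hE t : h t = \sum_i c i * \1_(Q i) t.
  by rewrite /h (big_morph (fun f : {nnsfun T >-> R} => f t) (id1 := 0) (op1 := +%R)).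
have -> : (\sum_i (c i)%:E * mu (Q i) = \int[mu]_t (h t)%:E)%E.
  transitivity (\int[mu]_t \sum_i (c i * \1_(Q i) t)%:E)%E; last first.
    by apply: eq_integral => t _; rewrite hE -sumEFin.
  rewrite ge0_integral_sum//; last 2 first.
  - move=> i; by apply/measurable_EFinP; apply: measurable_funM => //; exact: measurable_indic.
  - by move=> i t _; rewrite lee_fin mulr_ge0.
  apply: eq_bigr => i _; rewrite (integralZl_indic _ (fun=> Q i))//; last first.
    by rewrite ltNge c0.
  by rewrite integral_indic// setIT.
rewrite integral_nnsfun// ge0_integralTE// patch_setT.
apply: ereal_sup_ubound; exists h => // t; rewrite hE.
have [[i Qit]|nQ] := pselect (exists i, Q i t); last first.
  rewrite big1// => i _; rewrite indicE memNset ?mulr0// => Qit.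
  by apply: nQ; exists i.
rewrite (bigD1 i)//= big1 ?addr0 => [|j ji]; first by rewrite indicE mem_set// mulr1 cF.
rewrite indicE memNset ?mulr0// => Qjt; move/negP: ji; apply; apply/eqP.
by apply: tQ => //; exists t.
Qed.
End FiniteCovers.

(** * Boxes in the product space *)

Section Boxes.
Context {R : realType} {n : nat}.
Let T := measurableTypeR R.

Definition box (A : 'I_n -> set T) : set (n.-tuple T) :=
  [set t | forall i, A i (tnth t i)].

Lemma measurable_box (A : 'I_n -> set T) :
  (forall i, measurable (A i)) -> measurable (box A).
Proof.
move=> mA; rewrite (_ : box A = \big[setI/setT]_(i < n) ((@tnth _ T ^~ i) @^-1` A i)).
  apply: bigsetI_measurable => i _; rewrite -[X in measurable X]setTI.
  exact: measurable_tnth.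
by apply/seteqP; split=> t; rewrite -bigcap_seq /= => h i //;
  [move=> _; exact: h | exact: (h i (mem_index_enum i))].
Qed.

Lemma lebesgue_Rn_cube (A : 'I_n -> set T) (l : R) :
  (forall i, measurable (A i)) -> (forall i, lebesgue_measure (A i) = l%:E) ->
  lebesgue_Rn n (box A) = (l ^+ n)%:E.
Proof.
move=> mA lA; rewrite lebesgue_Rn_box// (eq_bigr (fun=> l%:E)) => [|i _]; last exact: lA.
by rewrite prodEFin prodr_const card_ord.
Qed.

End Boxes.

(** * Volume of the set of slopes *)

Section SlopeCovering.
Context {R : realType} {n : nat}.
Let T := measurableTypeR R.
Let N := n.+1.

Definition row_of (t : N.-tuple T) : 'rV[R]_N := \row_i tnth t i.

Definition cell (b r : R) (k : nat) : set T :=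
  `[- b + k%:R * r, - b + k.+1%:R * r[%classic.

Lemma cellP (b r : R) (k : nat) (s : R) : 0 < r ->
  cell b r k s -> Num.truncn ((s + b) / r) = k.
Proof.
move=> r0; rewrite /cell/= in_itv/= => /andP[h1 h2]; apply: truncn_def.
by rewrite ler_pdivlMr// ltr_pdivrMr//; apply/andP; split; lra.
Qed.

Lemma cell_truncn (b r s : R) : 0 < r -> - b <= s ->
  cell b r (Num.truncn ((s + b) / r)) s.
Proof.
move=> r0 bs; have : 0 <= (s + b) / r by rewrite divr_ge0 ?(ltW r0)//; lra.
move=> /truncn_itv; set k := Num.truncn _.
by rewrite ler_pdivlMr// ltr_pdivrMr// /cell/= in_itv/= => /andP[? ?]; apply/andP; split; lra.
Qed.

Lemma cell_dist (b r s s' : R) (k : nat) :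
  cell b r k s -> cell b r k s' -> `|s - s'| <= r.
Proof.
rewrite /cell/= !in_itv/= -(natr1 k) => /andP[? ?] /andP[? ?].
by rewrite ler_norml; apply/andP; split; lra.
Qed.

Lemma lebesgue_cell (b r : R) (k : nat) : 0 < r ->
  lebesgue_measure (cell b r k) = r%:E.
Proof.
move=> r0; rewrite /cell lebesgue_measure_itv/= lte_fin -natr1.
by rewrite ifT; [rewrite -EFinD; congr EFin; ring | lra].
Qed.

Lemma lebesgue_ball1 (a l : R) : 0 <= l ->
  lebesgue_measure (`[a - l, a + l]%classic : set T) = (2 * l)%:E.
Proof.
move=> l0; rewrite lebesgue_measure_itv/= lte_fin; case: ltP => h.
  by rewrite -EFinD; congr EFin; ring.
by congr EFin; lra.
Qed.

(** Separates the value used in the lower sum from the error [e]: x + e is at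
    most twice the larger of max(0, x - e) and 2 e. *)
Lemma exprn_max_add (x e : R) : 0 <= x -> 0 <= e ->
  (x + e) ^+ N <= 2 ^+ N * (Num.max 0 (x - e) ^+ N + (2 * e) ^+ N).
Proof.
move=> x0 e0; set c := Num.max 0 (x - e).
have c0 : 0 <= c by rewrite le_max lexx.
have ce : x - e <= c by rewrite le_max lexx orbT.
have e20 : 0 <= 2 * e by rewrite mulr_ge0.
have pw (u v : R) : 0 <= u -> u <= v -> u ^+ N <= v ^+ N.
  by move=> u0 uv; rewrite ler_pXn2r// nnegrE// (le_trans u0).
have [h|h] := leP c (2 * e).
  apply: (@le_trans _ _ ((2 * (2 * e)) ^+ N)); first by apply: pw; lra.
  by rewrite exprMn ler_wpM2l ?exprn_ge0// lerDr exprn_ge0.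
apply: (@le_trans _ _ ((2 * c) ^+ N)); first by apply: pw; lra.
by rewrite exprMn ler_wpM2l ?exprn_ge0// lerDl exprn_ge0.
Qed.

(** Slopes of points of [E] in one cell of the grid are within
    L r (g x + e) / alpha of one another, [x] being a point of [E] chosen in that
    cell.  Hence the cube of slopes of radius [h] is covered by one cube per
    occupied cell, and the sum of their volumes is compared with the lower sum
    of g^N in which the cell has the value max(0, g x - e)^N.  The abstract relation
    [C p x] stands for: [p] is a contact slope at [x]. *)
Lemma slope_volume_le (Om E : set 'rV[R]_N) (C : 'rV[R]_N -> 'rV[R]_N -> Prop)
    (g : 'rV[R]_N -> R) (alpha L b r h e J : R) (M : nat) :
  r = 2 * b / M%:R ->
  0 < alpha -> 0 <= L -> 0 < b -> 0 <= h -> 0 <= e -> (0 < M)%N ->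
  (forall x, 0 <= g x) -> (forall x, E x -> `|x| < b) ->
  (forall p, `|p| <= h -> exists2 x, E x & C p x) ->
  (forall x0 x1 p0 p1, E x0 -> E x1 -> C p0 x0 -> C p1 x1 -> `|x1 - x0| <= r ->
    alpha * `|p0 - p1| <= L * r * (g x0 + e)) ->
  (forall x y, E x -> `|y - x| <= r -> Om y /\ g x <= g y + e) ->
  (\int[lebesgue_Rn N]_t ((g \_ Om) (row_of t) ^+ N)%:E <= J%:E)%E ->
  (alpha * h) ^+ N <= (2 * L) ^+ N * (J + (4 * e * b) ^+ N).
Proof.
move=> rE alpha0 L0 b0 h0 e0 M0 g0 Eb hE gap near_g intJ.
have M0' : 0 < M%:R :> R by rewrite ltr0n.
have r0 : 0 < r by rewrite rE !mulr_gt0// invr_gt0.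
(* A cell of the grid is indexed by its position along each axis. *)
pose I := {ffun 'I_N -> 'I_M}.
pose incell (z : I) (x : 'rV[R]_N) := forall i, cell b r (z i) (x 0 i).
pose Q (z : I) := box (fun i => cell b r (z i)).
have mQ z : measurable (Q z) by apply: measurable_box => i; exact: measurable_itv.
have QE z t : Q z t = incell z (row_of t).
  by apply/propext; split => Qt i; have := Qt i; rewrite mxE.
have tQ : trivIset setT Q.
  move=> z z' _ _ [t [Qt Qt']]; apply/ffunP => i; apply/val_inj => /=.
  by rewrite -(cellP r0 (Qt i)) -(cellP r0 (Qt' i)).
have incell_dist z x y : incell z x -> incell z y -> `|x - y| <= r.
  move=> zx zy; apply: norm_le_coord; first exact: ltW.
  by move=> i; rewrite !mxE; exact: cell_dist.
have incell_ex x : E x -> exists z, incell z x.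
  move=> Ex; have xb (i : 'I_N) : - b < x 0 i < b.
    by rewrite -ltr_norml (le_lt_trans (coord_le_norm x i))// Eb.
  have ltM (i : 'I_N) : (Num.truncn ((x 0 i + b) / r)%R < M)%N.
    have /andP[? ?] := xb i.
    have xb0 : 0 <= (x 0 i + b) / r by rewrite divr_ge0 ?(ltW r0)//; lra.
    rewrite truncn_lt_nat// ltr_pdivrMr//.
    by rewrite rE mulrC divfK ?gt_eqF//; lra.
  exists [ffun i => Ordinal (ltM i)] => i; rewrite ffunE/=.
  by apply: cell_truncn => //; have /andP[/ltW] := xb i.
pose occ z := `[< exists x p, [/\ E x, C p x & incell z x] >].
have /choice[X XP] : forall z, exists xp : 'rV[R]_N * 'rV[R]_N,
    occ z -> [/\ E xp.1, C xp.2 xp.1 & incell z xp.1].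
  move=> z; have [/asboolP[x [p xp]]|nz] := boolP (occ z); first by exists (x, p).
  by exists (0, 0).
pose x_ z := (X z).1; pose p_ z := (X z).2.
pose rho z := L * r * (g (x_ z) + e) / alpha.
have rho0 z : 0 <= rho z.
  by rewrite divr_ge0 ?(ltW alpha0)// mulr_ge0 ?addr_ge0// mulr_ge0// ltW.
pose P z := box (fun i => `[p_ z 0 i - rho z, p_ z 0 i + rho z]%classic : set T).
have mP z : measurable (P z) by apply: measurable_box => i; exact: measurable_itv.
pose H : set (N.-tuple T) := box (fun=> `[0 - h, 0 + h]%classic : set T).
have mH : measurable H by apply: measurable_box => i; exact: measurable_itv.
have HP : H `<=` \big[setU/set0]_(z | occ z) P z.
  move=> t Ht; have : `|row_of t| <= h.
    apply: norm_le_coord => // i; rewrite mxE; have := Ht i.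
    by rewrite /= in_itv/= ler_norml sub0r add0r.
  move=> /hE[x Ex Cx]; have [z zx] := incell_ex _ Ex.
  have oz : occ z by apply/asboolP; exists x, (row_of t).
  have [Exz Cxz zxz] := XP z oz.
  rewrite (bigD1 z)//=; left.
  have := gap _ _ _ _ Exz Ex Cxz Cx (incell_dist _ _ _ zx zxz).
  rewrite -ler_pdivlMl// mulrC -/(rho z) => pt i /=.
  have := le_trans (coord_le_norm _ i) pt.
  by rewrite !mxE in_itv/= ler_norml => /andP[? ?]; apply/andP; split; lra.
have volH : lebesgue_Rn N H = ((2 * h) ^+ N)%:E.
  apply: lebesgue_Rn_cube => i; first exact: measurable_itv.
  exact: lebesgue_ball1.
have volP z : lebesgue_Rn N (P z) = ((2 * rho z) ^+ N)%:E.
  apply: lebesgue_Rn_cube => i; first exact: measurable_itv.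
  exact: lebesgue_ball1.
have volQ z : lebesgue_Rn N (Q z) = (r ^+ N)%:E.
  apply: lebesgue_Rn_cube => i; first exact: measurable_itv.
  exact: lebesgue_cell.
have : (((2 * h) ^+ N)%:E <= \sum_(z | occ z) ((2 * rho z) ^+ N)%:E)%E.
  rewrite -volH; apply: (@le_trans _ _ (\sum_(z | occ z) lebesgue_Rn N (P z))%E).
    exact: measure_le_sum_cover.
  by apply: lee_sum => z _; have <- := volP z.
rewrite sumEFin lee_fin => vol.
pose c z := if occ z then Num.max 0 (g (x_ z) - e) ^+ N else 0.
have c0 z : 0 <= c z by rewrite /c; case: ifP => // _; rewrite exprn_ge0// le_max lexx.
have sumJ : \sum_z c z * r ^+ N <= J.
  rewrite -lee_fin; apply: le_trans intJ.
  apply: (@le_trans _ _ (\sum_z (c z)%:E * lebesgue_Rn N (Q z))%E).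
    by rewrite -sumEFin; apply: lee_sum => z _; rewrite volQ.
  apply: (integral_ge_lower_sum (lebesgue_Rn N) mQ tQ c0).
    by move=> t; rewrite lee_fin exprn_ge0// /patch; case: ifP.
  move=> z t; rewrite QE lee_fin /c; case: ifPn => [oz zt|_ _]; last first.
    by rewrite exprn_ge0// /patch; case: ifP.
  have [Exz Cxz zxz] := XP z oz.
  have [Oy gy] := near_g _ _ Exz (incell_dist _ _ _ zt zxz).
  rewrite /patch mem_set// ler_pXn2r ?nnegrE ?le_max ?lexx//.
  by rewrite ge_max g0/=; lra.
(* Multiply by alpha^N and cancel the common factor 2^N. *)
have volN : (alpha * h) ^+ N <= \sum_(z | occ z) (L * r * (g (x_ z) + e)) ^+ N.
  rewrite -(ler_pM2l (exprn_gt0 N (ltr0Sn R 1))).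
  move: vol; rewrite -(ler_pM2l (exprn_gt0 N alpha0)).
  rewrite -exprMn mulrCA [X in X <= _]exprMn => /le_trans; apply.
  rewrite !mulr_sumr; apply: ler_sum => z _; rewrite -!exprMn /rho.
  by rewrite mulrCA [alpha * _]mulrC divfK ?gt_eqF.
apply: (le_trans volN).
apply: (@le_trans _ _ (\sum_z (2 * L) ^+ N * (c z * r ^+ N + (2 * e * r) ^+ N))).
  rewrite [leRHS](bigID occ)/= ler_wpDr//.
    apply: sumr_ge0 => z _; rewrite mulr_ge0 ?exprn_ge0 ?mulr_ge0// addr_ge0//.
      by rewrite mulr_ge0 ?exprn_ge0// ltW.
    by rewrite exprn_ge0// !mulr_ge0// ltW.
  apply: ler_sum => z oz; rewrite /c oz.
  have hL := ler_wpM2l (exprn_ge0 N L0)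
    (ler_wpM2l (ltW (exprn_gt0 N r0)) (exprn_max_add (g0 (x_ z)) e0)).
  apply: (@le_trans _ _ (L ^+ N * (r ^+ N * (g (x_ z) + e) ^+ N))).
    by rewrite !exprMn mulrA.
  apply: (le_trans hL); rewrite le_eqVlt; apply/orP; left; apply/eqP.
  by rewrite !exprMn; ring.
rewrite -mulr_sumr ler_wpM2l ?exprn_ge0 ?mulr_ge0// big_split/= lerD//.
rewrite sumr_const card_ffun !card_ord -[leLHS]mulr_natl natrX -exprMn.
rewrite (_ : M%:R * _ = 4 * e * b)//.
by rewrite rE; field; rewrite gt_eqF.
Qed.

End SlopeCovering.

(** * The one-sided estimate *)

Section OneSidedEstimate.
Context {R : realType} {n : nat}.
Implicit Types (x y p : 'rV[R]_n.+1) (u v f g : 'rV[R]_n.+1 -> R).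
Implicit Types (Omega : set 'rV[R]_n.+1).
Local Notation N := n.+1.

Lemma within_open_continuous Omega v : open Omega ->
  {within Omega, continuous v} -> forall y, Omega y -> {for y, continuous v}.
Proof.
by move=> oO; rewrite continuous_open_subspace// => vc y Oy; apply: vc; rewrite inE.
Qed.

Lemma le_perturbation (A D L b : R) : 0 <= D -> 0 <= b ->
  (forall e, 0 < e -> e <= 1 -> A <= D * (L + (4 * e * b) ^+ N)) -> A <= D * L.
Proof.
move=> D0 b0 hA; apply/ler_addgt0Pr => t t0.
pose q := D * (4 * b) ^+ N.
have q0 : 0 <= q by rewrite mulr_ge0// exprn_ge0// mulr_ge0.
pose e := Num.min 1 (t / (q + 1)).
have e0 : 0 < e by rewrite lt_min ltr01 divr_gt0//; lra.
have e1 : e <= 1 by rewrite ge_min lexx.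
apply: (le_trans (hA e e0 e1)); rewrite mulrDr lerD2l.
rewrite mulrAC exprMn mulrA -/q.
apply: (@le_trans _ _ (q * e)).
  rewrite ler_wpM2l// exprS ler_piMr ?(ltW e0)//.
  by rewrite exprn_ile1// ltW.
apply: (@le_trans _ _ (q * (t / (q + 1)))).
  by rewrite ler_wpM2l// ge_min lexx orbT.
rewrite mulrA ler_pdivrMr; [|lra].
by rewrite mulrC ler_pM2l//; lra.
Qed.

(** If the estimate failed, some [h] would lie strictly between
    12 N ell / alpha and (v x - b) / (N delta).  All slopes of size at most [h]
    are then contact slopes, while the volume bound says alpha h <= 12 N ell. *)
Lemma one_sided_estimate Omega v g x (alpha S b0 b delta ell : R) :
  open Omega -> compact (closure Omega) -> (forall y, Omega y -> `|y| < b0) ->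
  {within closure Omega, continuous v} ->
  (forall y, Omega y -> {for y, continuous g}) -> (forall y, 0 <= g y) ->
  rank1_subsolution alpha S g Omega v -> 0 < alpha -> 0 <= S ->
  (forall y, boundary Omega y -> v y <= b) -> Omega x ->
  (forall y, closure Omega y -> `|y - x| <= delta) -> 0 < delta -> 0 <= ell ->
  (\int[lebesgue_Rn N]_t ((g \_ Omega) (row_of t) ^+ N)%:E <= (ell ^+ N)%:E)%E ->
  v x <= b + 12 * N%:R ^+ 2 / alpha * delta * ell.
Proof.
move=> oO cO Ob0 vc gc g0 vsub alpha0 S0 vb Ox Od delta0 ell0 intg.
have N0 : 0 < N%:R :> R by rewrite ltr0n.
have b00 : 0 < b0 by rewrite (le_lt_trans _ (Ob0 _ Ox)).
rewrite leNgt; apply/negP => vx.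
pose lo := 12 * N%:R * ell / alpha; pose hi := (v x - b) / (N%:R * delta).
have lo0 : 0 <= lo by rewrite divr_ge0 ?(ltW alpha0)// !mulr_ge0// ltW.
have lohi : lo < hi.
  rewrite /hi ltr_pdivlMr ?mulr_gt0// ltrBrDl.
  by rewrite (_ : lo * _ = 12 * N%:R ^+ 2 / alpha * delta * ell)// /lo; ring.
have [h lo_h h_hi] : exists2 h, lo < h & h < hi.
  by have [? ?] := midf_lt lohi; exists ((lo + hi) / 2).
have h0 : 0 <= h by rewrite (le_trans lo0)// ltW.
have hb : N%:R * h * delta < v x - b.
  by move: h_hi; rewrite /hi ltr_pdivlMr ?mulr_gt0// mulrCA mulrA.
pose E := closure Omega `&` [set y | v x - N%:R * h * delta <= v y].
have cE : compact E by exact: superlevel_compact.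
have EO : E `<=` Omega.
  move=> y [cy vy]; apply: contrapT => nOy.
  have : v y <= b by apply: vb; split => // /interior_subset.
  by move: vy => /=; lra.
have vcont := within_open_continuous oO (continuous_subspaceW (@subset_closure _ Omega) vc).
suff : (alpha * h) ^+ N <= (12 * N%:R) ^+ N * ell ^+ N.
  rewrite -exprMn ler_pXn2r ?nnegrE ?mulr_ge0 ?(ltW alpha0)//.
  by rewrite leNgt [alpha * h]mulrC -ltr_pdivrMr// -/lo lo_h.
apply: (@le_perturbation _ _ _ b0); rewrite ?exprn_ge0 ?mulr_ge0 ?(ltW b00)//.
move=> e e0 e1.
have [rho rho0 near_rho] := compact_uniform_near oO cE EO gc e0.
(* eta <= 1 gives eta^2 <= eta, so a grid of mesh r < rho eta satisfies the
   smallness condition 12 N^2 S r^2 <= alpha rho^2 of the slope estimate. *)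
pose eta := alpha / (12 * N%:R ^+ 2 * S + alpha).
have S120 : 0 <= 12 * N%:R ^+ 2 * S by rewrite !mulr_ge0// exprn_ge0// ltW.
have den0 : 0 < 12 * N%:R ^+ 2 * S + alpha by rewrite ltr_wpDl.
have eta0 : 0 < eta by rewrite divr_gt0.
have eta1 : eta <= 1 by rewrite ler_pdivrMr// mul1r lerDr.
have etaS : 12 * N%:R ^+ 2 * S * eta <= alpha.
  by rewrite mulrCA ler_piMr ?(ltW alpha0)// ler_pdivrMr// mul1r lerDl ltW.
pose M := (Num.truncn (2 * b0 / (rho * eta))).+1.
pose r := 2 * b0 / M%:R.
have M0 : 0 < M%:R :> R by rewrite ltr0n.
have r0 : 0 < r by rewrite !mulr_gt0// invr_gt0.
have re0 : 0 < rho * eta by exact: mulr_gt0.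
have r_lt : r < rho * eta.
  rewrite /r ltr_pdivrMr// [ltRHS]mulrC -ltr_pdivrMr//.
  exact: truncnS_gt.
have r_rho : r <= rho.
  by rewrite (le_trans (ltW r_lt))// ler_piMr// ltW.
have Sr : 12 * N%:R ^+ 2 * S * r ^+ 2 <= alpha * rho ^+ 2.
  apply: (@le_trans _ _ (12 * N%:R ^+ 2 * S * (eta * rho ^+ 2))).
    rewrite ler_wpM2l// (@le_trans _ _ ((rho * eta) ^+ 2))//.
      by rewrite ler_pXn2r// ?nnegrE ltW.
    by rewrite exprMn mulrC ler_wpM2r ?sqr_ge0// expr2 ler_piMr// ltW.
  by rewrite mulrA ler_wpM2r ?sqr_ge0.
rewrite (_ : 12 * N%:R = 2 * (6 * N%:R)); last by ring.
apply: (@slope_volume_le _ _ Omega E (contact Omega v) g alpha (6 * N%:R) b0 r h e _ M) => //.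
- exact: ltW.
- by move=> y /EO; exact: Ob0.
- move=> p ph; have [y [Oy cy vy]] := contact_exists oO cO vc vb Ox Od hb ph.
  by exists y => //; split => //; exact: subset_closure.
- move=> x0 x1 p0 p1 Ex0 Ex1 c0 c1 x10.
  have ballO y : `|y - x0| <= rho -> Omega y by move=> /(near_rho _ _ Ex0)[].
  have [y yx0 /le_trans] := contact_slope_gap vsub vcont g0 alpha0 r0 rho0 Sr
    ballO (EO _ Ex1) x10 c0 c1.
  have Nr0 : 0 <= 6 * N%:R * r by rewrite !mulr_ge0// ltW.
  apply; rewrite ler_wpM2l//.
  have [_] := near_rho _ _ Ex0 yx0.
  by rewrite ler_norml => /andP[? ?]; lra.
- move=> y z Ey zy; have [Oz] := near_rho _ _ Ey (le_trans zy r_rho).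
  by rewrite ler_norml => /andP[? ?]; split => //; lra.
Qed.

(** * From viscosity solutions to the barrier inequality *)

Lemma superjet_opp u x xi (X : 'M[R]_n.+1) :
  superjet (fun y => - u y) x xi X -> subjet u x (- xi) (- X).
Proof.
move=> [r [/eqoP ro ur]]; exists (fun y => - r y); split.
  apply/eqoP => e e0; apply: filterS (ro e e0) => y; by rewrite normrN.
apply: filterS ur => y; rewrite /quadratic mulmxN !dotpNl.
lra.
Qed.

Lemma visc_subsolution_rank1 (a : 'I_n.+1 -> R) f Omega u :
  (forall i, 0 <= a i) -> visc_subsolution (weightedM a) f Omega u ->
  rank1_subsolution (a ord0) (\sum_i a i) (fun y => `|f y|) Omega u.
Proof.
move=> a0 [_ usub] x xi d k w Ox k0 jet.
have := usub _ _ _ Ox (rank1_hess_sym d k w) jet.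
have := weightedM_rank1_le d w a0 k0; have := ler_norm (- f x); rewrite normrN.
lra.
Qed.

Lemma visc_supersolution_rank1 (a : 'I_n.+1 -> R) f Omega u :
  (forall i, 0 <= a i) -> visc_supersolution (weightedM a) f Omega u ->
  rank1_subsolution (a ord_max) (\sum_i a i) (fun y => `|f y|) Omega
    (fun y => - u y).
Proof.
move=> a0 [_ usup] x xi d k w Ox k0 /superjet_opp jet.
have Xs : (- rank1_hess d k w)^T = - rank1_hess d k w.
  by rewrite linearN/= rank1_hess_sym.
have := usup _ _ _ Ox Xs jet.
have := weightedM_rank1_ge d w a0 k0; have := ler_norm (f x).
lra.
Qed.

Lemma norm_le_diameter Omega x y : bounded_set Omega ->
  Omega x -> closure Omega y -> `|y - x| <= diameter Omega.
Proof.
move=> bO Ox.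
have hs : has_sup [set enorm (p.1 - p.2) | p in Omega `*` Omega].
  split; first by exists (enorm (x - x)), (x, x).
  have [M [_ /(_ (M + 1))]] := bO; rewrite ltrDl => /(_ ltr01) OM.
  exists (N%:R * ((M + 1) + (M + 1)) + 1) => _ [[p q] [/= Op Oq] <-].
  apply: enorm_le_norm; apply: (le_trans (ler_normB _ _)).
  by apply: lerD; exact: OM.
have cl : closed [set z : 'rV[R]_N | `|z - x| <= diameter Omega].
  apply: (@preimage_closed _ _ (fun z : 'rV[R]_N => `|z - x|) [set t | t <= diameter Omega]).
    move=> z _; apply: (@continuous_comp _ _ _ (fun z : 'rV[R]_N => z - x)).
      exact: sub_continuous.
    exact: norm_continuous.
  exact: closed_le.
have sub : Omega `<=` [set z : 'rV[R]_N | `|z - x| <= diameter Omega].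
  move=> z Oz; apply: (le_trans (norm_le_enorm _)).
  by apply: sup_upper_bound => //; exists (z, x).
by move=> /(closureS sub); rewrite -(closure_id _).1.
Qed.

End OneSidedEstimate.

(** * The Alexandrov-Bakelman-Pucci estimate *)

Section Conclusion.
Context {R : realType} {n : nat}.
Implicit Types (x y : 'rV[R]_n.+1) (u f : 'rV[R]_n.+1 -> R).
Implicit Types (Omega : set 'rV[R]_n.+1).

Lemma diameter_gt0 Omega : open Omega -> Omega !=set0 -> bounded_set Omega ->
  0 < diameter Omega.
Proof.
move=> oO [y Oy] bO; have [e e0 Oz] := open_shift oO Oy.
have := norm_le_diameter bO Oy (subset_closure Oz); apply: lt_le_trans.
apply: lt_le_trans (coord_le_norm _ ord0).
by rewrite !mxE addrC addKr gtr0_norm.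
Qed.

Lemma integral_Lp_norm Omega f (l : R) : 0 <= l ->
  Lp_norm n.+1%:R Omega f = l%:E ->
  (\int[lebesgue_Rn n.+1]_t
     (((fun y => `|f y|) \_ Omega) (row_of t) ^+ n.+1)%:E)%E = (l ^+ n.+1)%:E.
Proof.
move=> l0 fl; have N0 : n.+1%:R != 0 :> R by rewrite pnatr_eq0.
have : (Lp_norm n.+1%:R Omega f `^ n.+1%:R)%E = _ :=
  poweR_Lnorm (lebesgue_Rn n.+1) _ N0.
rewrite fl poweR_EFin powR_mulrn// => ->.
apply: eq_integral => t _; rewrite /= powR_mulrn// /patch.
by case: ifP => // _; rewrite normr0.
Qed.

End Conclusion.

Theorem theorem1p1 (R : realType) (n : nat) :
  exists C : R, 0 < C /\
  forall (Omega : set 'rV[R]_n.+1) (f u : 'rV[R]_n.+1 -> R)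
         (a : 'I_n.+1 -> R),
    open Omega -> Omega !=set0 -> bounded_set Omega ->
    {within Omega, continuous f} -> [bounded f x | x in Omega] ->
    {within closure Omega, continuous u} ->
    classA a ->
    visc_solution (weightedM a) f Omega u ->
    (ereal_sup [set `|u x|%:E | x in Omega] <=
     ereal_sup [set `|u x|%:E | x in boundary Omega] +
     (C / astar a)%:E * (diameter Omega)%:E * Lp_norm n.+1%:R Omega f)%E.
Proof.
pose N : R := n.+1%:R.
have N0 : 0 < N by rewrite ltr0n.
exists (12 * N ^+ 2); split; first by rewrite mulr_gt0// exprn_gt0.
move=> Omega f u a oO O0 bO fc _ uc [[a0 _] a1 an] [_ usub usup].
have as0 : 0 < astar a by rewrite lt_min a1.
have cO : compact (closure Omega).
  have [M [Mr /= OM]] := bO.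
  have [x0 Ox0] := O0; apply: bounded_closed_compact; last exact: closed_closure.
  exists (`|x0| + diameter Omega); split; first exact: num_real.
  move=> k kM y cy; apply: (le_trans _ (ltW kM)).
  rewrite -[y](subrK x0) addrC; apply: (le_trans (ler_normD _ _)).
  by apply: lerD => //; exact: norm_le_diameter.
have d0 := diameter_gt0 oO O0 bO.
set d := diameter Omega in d0 *.
set l := Lp_norm _ _ _.
have l_ge0 : (0 <= l)%E by exact: Lnorm_ge0.
have Cd0 : (0 < (12 * N ^+ 2 / astar a)%:E * d%:E)%E.
  by rewrite -EFinM lte_fin !mulr_gt0// ?invr_gt0// exprn_gt0.
set B := ereal_sup [set `|u x|%:E | x in boundary Omega].
have [y0 by0] := boundary_nonempty oO O0 cO.
have B_ge0 : (0 <= B)%E.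
  apply: (@le_trans _ _ `|u y0|%:E); first by rewrite lee_fin.
  by apply: ereal_sup_ubound; exists y0.
apply: ge_ereal_sup => _ [x Ox <-].
(* An infinite term makes the right side infinite, since the other terms are
   nonnegative and the coefficient of the norm is positive. *)
have [l_fin|] := boolP (l \is a fin_num); last first.
  rewrite ge0_fin_numE// -leNgt leye_eq => /eqP ->.
  by rewrite gt0_muley// addey ?leey// gt_eqF// (lt_le_trans _ B_ge0).
have [B_fin|] := boolP (B \is a fin_num); last first.
  rewrite ge0_fin_numE// -leNgt leye_eq => /eqP ->.
  rewrite addye ?leey// gt_eqF//; apply: lt_le_trans (mule_ge0 (ltW Cd0) l_ge0).
  exact: ltNy0.
have bB y : boundary Omega y -> `|u y| <= fine B.
  by move=> bOy; rewrite -lee_fin fineK//; apply: ereal_sup_ubound; exists y.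
have fl0 : 0 <= fine l by exact: fine_ge0.
rewrite -(fineK l_fin) -(fineK B_fin) -!EFinM -EFinD lee_fin.
have intf := integral_Lp_norm fl0 (esym (fineK l_fin)).
have S0 : 0 <= \sum_i a i by apply: sumr_ge0.
have fcont := within_open_continuous oO fc.
have gc y : Omega y -> {for y, continuous (fun z => `|f z|)}.
  by move=> Oy; apply: continuous_comp; [exact: fcont|exact: norm_continuous].
have [b0 Ob0] : exists b0, forall y, Omega y -> `|y| < b0.
  have [M [_ /(_ (M + 1))]] := bO; rewrite ltrDl => /(_ ltr01) OM.
  by exists (M + 1 + 1) => y /OM/le_lt_trans; apply; rewrite ltrDl.
have Od y : closure Omega y -> `|y - x| <= d by exact: norm_le_diameter.
have upper alpha v : rank1_subsolution alpha (\sum_i a i) (fun y => `|f y|) Omega v ->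
    {within closure Omega, continuous v} -> astar a <= alpha ->
    (forall y, boundary Omega y -> v y <= fine B) ->
    v x <= fine B + 12 * N ^+ 2 / astar a * d * fine l.
  move=> vsub vc a_alpha vB; have alpha0 := lt_le_trans as0 a_alpha.
  have := one_sided_estimate oO cO Ob0 vc gc (fun y => normr_ge0 (f y)) vsub alpha0 S0
    vB Ox Od d0 fl0.
  rewrite intf lexx => /(_ isT) /le_trans; apply.
  rewrite lerD2l ler_wpM2r// ler_wpM2r ?(ltW d0)// ler_wpM2l//.
  by rewrite lef_pV2.
rewrite ler_norml lerNl; apply/andP; split.
  apply: (upper _ (fun y => - u y) (visc_supersolution_rank1 a0 usup)).
  - by move=> y; apply: continuousN; exact: uc.
  - by rewrite ge_min lexx orbT.
  - by move=> y /bB; apply: le_trans; rewrite -normrN ler_norm.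
apply: (upper _ u (visc_subsolution_rank1 a0 usub)) => //.
- by rewrite ge_min lexx.
- by move=> y /bB; apply: le_trans; rewrite ler_norm.
Qed.
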